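(* Let $\mathcal{X}$ be a complete separable metric space with Borel sigma field $\mathcal{S}$, let $\mu$ be a probability measure on $(\mathcal{X}, \mathcal{S})$, and let $T$ be a $\mu$-measure preserving transformation of $(\mathcal{X}, \mathcal{S})$. If $\mathcal{C} \subseteq \mathcal{S}$ is a countable VC-class of measurable sets and $T$ is weakly mixing, then $$\lim_{n \to \infty} \sup_{A, B \in \mathcal{C}} \frac{1}{n} \sum_{i=0}^{n-1} \left| \mu(A \cap T^{-i} B) - \mu(A)\mu(B) \right| = 0.$$
   Context: A family $\mathcal{C} \subseteq \mathcal{S}$ of measurable sets is a Vapnik-Chervonenkis (VC) class if there is a finite integer $k$ such that $|\{ C \cap D : C \in \mathcal{C} \}| < 2^k$ for every $D \subseteq \mathcal{X}$ with $|D| = k$, where $|\cdot|$ denotes cardinality. A measure preserving transformation $T$ is weakly mixing if for all measurable sets $A$ and $B$, $$\lim_{n \to \infty} \frac{1}{n} \sum_{i=0}^{n-1} \left| \mu(A \cap T^{-i} B) - \mu(A)\mu(B) \right| = 0.$$ *)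

(* Defs.v *)
From HB Require Import structures.
From mathcomp Require Import all_boot all_order all_algebra.
From mathcomp Require Import all_classical all_reals all_analysis.

Set Implicit Arguments.
Unset Strict Implicit.
Unset Printing Implicit Defensive.

Import Order.TTheory GRing.Theory Num.Theory.
Import numFieldNormedType.Exports.

Local Open Scope classical_set_scope.
Local Open Scope ring_scope.

(* [Complete] includes a distinguished point, which costs no generality: a
   space carrying a probability measure is nonempty. *)
#[short(type="completeMetricType")]
HB.structure Definition CompleteMetric (R : numDomainType) :=
  { M of Complete M & Metric R M }.

Definition separable (X : topologicalType) : Prop :=
  exists D : set X, countable D /\ dense D.

Notation borelType X := (g_sigma_algebraType (@open X)).

Definition measure_preserving (R : realType) (d : measure_display)
    (X : measurableType d) (mu : probability X R) (T : X -> X) : Prop :=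
  measurable_fun [set: X] T /\
  forall B : set X, measurable B -> mu (T @^-1` B) = mu B.

(* [(D #= `I_k)%card] says that D has exactly k elements; the inner
   existential says that the family of traces on D is finite, with fewer than
   2 ^ k members. *)
Definition VC_class (d : measure_display) (X : measurableType d)
    (C : set (set X)) : Prop :=
  C `<=` measurable /\
  exists k : nat, forall D : set X, (D #= `I_k)%card ->
    exists m : nat, ([set A `&` D | A in C] #= `I_m)%card /\ (m < 2 ^ k)%N.

(* The measure takes finite values, so [fine] loses no information; the term
   of index n = 0 is 0 and is irrelevant to limits. *)
Definition mixing_avg (R : realType) (d : measure_display)
    (X : measurableType d) (mu : probability X R) (T : X -> X)
    (A B : set X) (n : nat) : R :=
  n%:R^-1 * \sum_(i < n)
    `| fine (mu (A `&` iter i T @^-1` B)) - fine (mu A) * fine (mu B) |.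

Definition weakly_mixing (R : realType) (d : measure_display)
    (X : measurableType d) (mu : probability X R) (T : X -> X) : Prop :=
  forall A B : set X, measurable A -> measurable B ->
    mixing_avg mu T A B n @[n --> \oo] --> (0 : R).

(* Main.v *)
Require Import Defs.
From mathcomp Require Import all_boot all_order all_algebra.
From mathcomp Require Import all_classical all_reals all_analysis.
From mathcomp Require Import measurable_realfun zify ring lra.
Import Order.TTheory GRing.Theory Num.Theory.
Import numFieldNormedType.Exports.
Local Open Scope classical_set_scope.
Local Open Scope ring_scope.

(** The mixing averages are Lipschitz in [A] and [B] for the pseudometric
    [mu (A `+` A')] ([mixing_avg_lipschitz]): [iter i T] preserves [mu], so
    replacing [A] by [A'] and [B] by [B'] moves each of the averaged terms by at
    most twice the sum of the two distances, uniformly in [n].  If [C] is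
    totally bounded for this pseudometric, the supremum over [C] is therefore
    controlled, up to a small error, by the finitely many pairs of elements of a
    finite net, and weak mixing makes each of these finitely many averages small
    ([VC_weakly_mixing_uniform]).

    A VC class is totally bounded in [L1 mu] for every probability [mu]
    ([VC_totally_bounded]), by the packing argument of Dudley.  Suppose that
    [N] members of the class are pairwise more than [e] apart.  Each of the at
    most [N ^ 2] symmetric differences has measure more than [e]; hence some
    point lies in at least a fraction [e] of them, another point in a fraction
    [e] of those that remain, and so on, so that [m] greedily chosen points meet
    all of them as soon as [(1 - e) ^+ m * N ^ 2 < 1] ([few_points_hit_all]).
    The [N] sets then leave [N] distinct traces on these [m] points, and the
    Sauer-Shelah lemma bounds the number of traces by [(m + 1) ^ k]
    ([VC_trace_growth]).  Exponential decay beats polynomial growth, so for a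
    suitable [m] the value [N = (m + 1) ^ k + 1] is impossible. *)

Set Implicit Arguments.
Unset Strict Implicit.
Unset Printing Implicit Defensive.

(** * The Sauer-Shelah lemma *)

(** A pattern on [n] points is a tuple of booleans, and a subset of the points
    is a mask; this keeps the induction on [n] below free of any carrier. *)
Definition shattered_by (n : nat) (F : {set n.-tuple bool}) (m : bitseq) :=
  forall b : bitseq, size b = count id m -> exists2 t : n.-tuple bool, t \in F & mask m t = b.

Definition cons_fiber (n : nat) (b : bool) (F : {set n.+1.-tuple bool}) : {set n.-tuple bool} :=
  [set t : n.-tuple bool | cons_tuple b t \in F]%SET.

Lemma cons_tuple_inj (n : nat) (b : bool) : injective (fun t : n.-tuple bool => cons_tuple b t).
Proof. by move=> s t /(congr1 val) [] /val_inj. Qed.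

Lemma card_cons_fiber (n : nat) (F : {set n.+1.-tuple bool}) :
  #|F| = (#|cons_fiber true F| + #|cons_fiber false F|)%N.
Proof.
pose I b := [set cons_tuple b t | t in cons_fiber b F]%SET.
have cI b : #|I b| = #|cons_fiber b F| by rewrite card_imset //; exact: cons_tuple_inj.
rewrite -!cI -cardsUI.
have -> : (I true :&: I false = finset.set0)%SET.
  apply/setP => t; rewrite !inE; apply/negP => /andP[/imsetP[u _ ->] /imsetP[v _]].
  by move/(congr1 val).
rewrite finset.cards0 addn0; apply: eq_card => t; rewrite inE.
case/tupleP: t => b t.
apply/idP/orP => [tF|[] /imsetP[u]]; last 2 first.
- by rewrite inE => uF ->.
- by rewrite inE => uF ->.
by case: b tF => tF; [left|right]; apply/imsetP; exists t; rewrite ?inE.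
Qed.

(** Delete the first point.  The patterns on the other points form the union of
    the two fibers, and those that extend in both ways form the intersection;
    the two cardinalities add up to [#|F|].  Either the union is large and
    shatters [k] of the remaining points, or the intersection is large, shatters
    [k - 1] of them, and adjoining the first point keeps the set shattered.  The
    bound [n.+1 ^ k] is cruder than the sum of binomial coefficients but obeys
    the recursion [n.+1 ^ k.+1 + n.+1 ^ k <= n.+2 ^ k.+1] that this needs. *)
Lemma sauer_shelah (n k : nat) (F : {set n.-tuple bool}) :
  (n.+1 ^ k < #|F|)%N ->
  exists m : bitseq, [/\ size m = n, count id m = k & shattered_by F m].
Proof.
elim: n k F => [|n IHn] k F.
  rewrite exp1n => F1; suff : (#|F| <= 1)%N by lia.
  by rewrite (leq_trans (max_card _)) // card_tuple expn0.
case: k => [|k] cF.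
  exists (nseq n.+1 false); rewrite size_nseq count_nseq mul0n; split => // b.
  have /card_gt0P[t tF] : (0 < #|F|)%N by lia.
  rewrite count_nseq mul0n => /size0nil ->; exists t => //.
  by rewrite mask_false.
set F1 := cons_fiber true F; set F0 := cons_fiber false F.
have := cardsUI F1 F0; rewrite -card_cons_fiber => cUI.
have [cU|cU] := ltnP (n.+1 ^ k.+1) #|F1 :|: F0|.
  have [m [sm cm shm]] := IHn _ _ cU.
  exists (false :: m); split => /=; [by rewrite sm|by rewrite cm add0n|].
  move=> b; rewrite /= add0n => /shm [t]; rewrite !inE => /orP[] tF tb.
  - by exists (cons_tuple true t).
  - by exists (cons_tuple false t).
have cI : (n.+1 ^ k < #|F1 :&: F0|)%N.
  suff : (n.+1 ^ k.+1 + n.+1 ^ k <= n.+2 ^ k.+1)%N by lia.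
  rewrite !expnS -mulSnr leq_mul2l /=; by case: (k) => [|i] //; rewrite leq_exp2r ?leqnSn.
have [m [sm cm shm]] := IHn _ _ cI.
exists (true :: m); split => /=; [by rewrite sm|by rewrite cm|].
case=> [|b0 b] //= [] /shm [t]; rewrite !inE => /andP[t1 t0] tb.
by exists (cons_tuple b0 t); [case: b0|rewrite /= tb].
Qed.

(** * Exponential decay against polynomial growth *)

(** With [d] the degree of the polynomial, take [m] a multiple [d.+1 * j].
    Bernoulli's inequality gives [(1 - e) ^+ m <= L ^- d.+1] for
    [L = 1 + j * e], while the polynomial is at most a constant times [L ^+ d];
    one spare factor [L] remains, and it is unbounded in [j]. *)
Lemma exp_beats_poly (R : realType) (e : R) (k : nat) : 0 < e -> e <= 1 ->
  exists m : nat, (1 - e) ^+ m * ((m.+1 ^ k).+1 ^ 2)%:R < 1.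
Proof.
move=> e0 e1; set d := (k * 2)%N.
(* [K] is the ratio of the slopes in [j] of [m = d.+1 * j] and of
   [L = 1 + j * e], which makes [m.+1 <= K * L]. *)
set K := d.+1%:R / e.
have [j Hj] : exists j : nat, 4 * K ^+ d < 1 + j%:R * e.
  exists (Num.truncn (4 * K ^+ d / e)).+1.
  have := truncnS_gt (4 * K ^+ d / e).
  rewrite ltr_pdivrMr //; lra.
exists (d.+1 * j)%N; set m := (d.+1 * j)%N; set L := 1 + j%:R * e in Hj *.
have K0 : 0 < K by rewrite divr_gt0.
have L1 : 1 <= L by rewrite lerDl mulr_ge0 // ltW.
have bern : L <= (1 + e) ^+ j.
  rewrite /L; elim: (j) => [|i IH]; first by rewrite mul0r addr0 expr0.
  rewrite exprS; apply: le_trans (_ : (1 + e) * (1 + i%:R * e) <= _).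
    2: by rewrite ler_wpM2l //; lra.
  rewrite -natr1; have : 0 <= i%:R * e * e by rewrite !mulr_ge0 // ltW.
  lra.
have q : (1 - e) ^+ m * L ^+ d.+1 <= 1.
  apply: (@le_trans _ _ ((1 - e) ^+ m * (1 + e) ^+ m)).
    rewrite ler_wpM2l ?exprn_ge0 //; first by lra.
    by rewrite /m mulnC exprM lerXn2r // nnegrE; lra.
  rewrite -exprMn exprn_ile1 //; nra.
have p : ((m.+1 ^ k).+1 ^ 2)%:R <= 4 * (K ^+ d * L ^+ d).
  have h1 : ((m.+1 ^ k).+1 ^ 2 <= 4 * m.+1 ^ d)%N.
    rewrite /d expnM; have : (0 < m.+1 ^ k)%N by rewrite expn_gt0.
    move: (m.+1 ^ k)%N => a; nia.
  apply: (@le_trans _ _ (4 * m.+1%:R ^+ d)).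
    by rewrite -natrX -natrM ler_nat.
  have mKL : m.+1%:R <= K * L.
    have -> : K * L = K + m%:R by rewrite /K /L /m natrM; field; lra.
    rewrite -natr1 addrC lerD2r /K ler_pdivlMr // mul1r (le_trans e1) //.
    by rewrite ler1n.
  by rewrite ler_wpM2l // -exprMn lerXn2r // nnegrE ?ler0n // (le_trans _ mKL).
have [->|q0] := eqVneq ((1 - e) ^+ m) 0; first by rewrite mul0r.
have {}q0 : 0 < (1 - e) ^+ m by rewrite lt_def q0 exprn_ge0 //; lra.
apply: (@le_lt_trans _ _ ((1 - e) ^+ m * (4 * (K ^+ d * L ^+ d)))).
  by rewrite ler_wpM2l // ltW.
apply: lt_le_trans q; rewrite ltr_pM2l // mulrA exprS ltr_pM2r // exprn_gt0 //; lra.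
Qed.

(** * Points that meet many sets of large measure *)

(** The number of sets of [P] that contain [x] integrates to the sum of their
    measures, which for nonempty [P] is more than [e * size P], so it cannot
    stay below that value everywhere. *)
Lemma exists_popular_point (R : realType) (d : measure_display) (X : measurableType d)
    (mu : probability X R) (I : Type) (S : I -> set X) (e : R) (P : seq I) :
  (forall i, measurable (S i)) -> (forall i, e < fine (mu (S i))) ->
  exists x : X, e * (size P)%:R <= (count (fun i => x \in S i) P)%:R.
Proof.
move=> mS eS; apply: contrapT => noX.
have cnt x : (count (fun i => x \in S i) P)%:R = \sum_(i <- P) \1_(S i) x :> R.
  by rewrite -sum1_count natr_sum big_mkcond; apply: eq_bigr => i _; rewrite indicE; case: ifP.
have sumS : \sum_(i <- P) fine (mu (S i)) <= e * (size P)%:R.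
  have intS : (\int[mu]_x (\sum_(i <- P) (\1_(S i) x)%:E) = (\sum_(i <- P) fine (mu (S i)))%R%:E)%E.
    rewrite ge0_integral_sum //.
    - rewrite -sumEFin; apply: eq_bigr => i _.
      by rewrite integral_indic // setIT fineK // fin_num_measure.
    - by move=> i; apply/measurable_EFinP; exact: measurable_indic.
  rewrite -lee_fin -intS.
  apply: (@le_trans _ _ (\int[mu]_x (cst (e * (size P)%:R)%:E x))%E).
    apply: ge0_le_integral => //.
    - by move=> x _; apply: sume_ge0 => i _; rewrite lee_fin.
    - by apply: emeasurable_sum => i; apply/measurable_EFinP; exact: measurable_indic.
    - move=> x _; rewrite sumEFin -cnt lee_fin leNgt; apply/negP => lt.
      by apply: noX; exists x; exact: ltW.
  by rewrite integral_cst // -[leRHS]mule1 -(probability_setT mu).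
case: P noX cnt sumS => [|i0 P] noX cnt sumS.
  by apply: noX; exists point; rewrite /= mulr0.
move: sumS; apply/negP; rewrite -ltNge.
have -> : e * (size (i0 :: P))%:R = \sum_(i <- i0 :: P) e.
  by rewrite big_const_seq count_predT iter_addr_0 mulr_natr.
rewrite !big_cons ltr_leD //; apply: ler_sum => i _; exact: ltW.
Qed.

(** Choosing popular points one after the other multiplies the number of sets
    not yet met by at most [1 - e] each time; once this number is below 1 it
    is 0.  This replaces the random sample of [m] points in the usual argument,
    and with it the product measure. *)
Lemma few_points_hit_all (R : realType) (d : measure_display) (X : measurableType d)
    (mu : probability X R) (I : Type) (S : I -> set X) (e : R) (P : seq I) (m : nat) :
  e <= 1 -> (forall i, measurable (S i)) -> (forall i, e < fine (mu (S i))) ->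
  (1 - e) ^+ m * (size P)%:R < 1 ->
  exists2 s : seq X, size s = m & all (fun i => has (fun x => x \in S i) s) P.
Proof.
move=> e1 mS eS small.
have [s ss cs] : exists2 s : seq X, size s = m &
    (count (fun i => ~~ has (fun x => x \in S i) s) P)%:R <= (1 - e) ^+ m * (size P)%:R.
  elim: {small}m => [|m [s ss cs]].
    by exists [::] => //; rewrite count_predT expr0 mul1r.
  set P' := [seq i <- P | ~~ has (fun x => x \in S i) s].
  have [x hx] := @exists_popular_point _ _ _ mu I S e P' mS eS.
  exists (x :: s); first by rewrite /= ss.
  have -> : count (fun i => ~~ has (fun x => x \in S i) (x :: s)) P =
            count (fun i => x \notin S i) P'.
    by rewrite count_filter; apply: eq_count => i /=; rewrite negb_or.
  rewrite -size_filter -/P' in cs.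
  have := count_predC (fun i => x \in S i) P' => /(congr1 (fun n => n%:R : R)).
  rewrite natrD /= -/(count _ _) => E.
  have -> : (count (fun i => x \notin S i) P')%:R =
      (size P')%:R - (count (fun i => x \in S i) P')%:R :> R.
    by rewrite -E addrAC subrr add0r.
  apply: le_trans (_ : (1 - e) * (size P')%:R <= _); first by lra.
  by rewrite exprS -mulrA ler_wpM2l //; lra.
exists s => //; have := le_lt_trans cs small.
by rewrite ltrn1 -[all _ _]negbK -has_predC has_count -leqNgt.
Qed.

(** * Traces of VC classes on finite sets *)

Lemma card_uniq_seq (T : choiceType) (s : seq T) : uniq s -> ([set` s] #= `I_(size s))%card.
Proof.
move=> us; apply/card_set_bijP; exists (index^~ s); split.
- by move=> x /=; rewrite index_mem.
- by move=> x y /set_mem xs /set_mem ys; exact: index_inj.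
- move=> i /= si; case: s us si => // x0 s us si.
  by exists (nth x0 (x0 :: s) i); [exact: mem_nth|rewrite index_uniq].
Qed.

(** The link between patterns, as boolean sequences, and traces, as sets:
    distinct patterns on [s] come from distinct intersections with [s]. *)
Lemma patterns_le_traces (T : choiceType) (C : set (set T)) (s : seq T) (m : nat) :
  uniq s ->
  (forall b : bitseq, size b = size s -> exists2 A, C A & [seq x \in A | x <- s] = b) ->
  ([set A `&` [set` s] | A in C] #= `I_m)%card -> (2 ^ size s <= m)%N.
Proof.
move=> us shat /card_set_bijP [f [fI finj _]].
have /choice[g gP] : forall b : (size s).-tuple bool, exists A, C A /\ [seq x \in A | x <- s] = b.
  by move=> b; have [|A CA Ab] := shat b; [rewrite size_tuple|exists A].
have tr b : [set A `&` [set` s] | A in C] (g b `&` [set` s]).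
  by exists (g b) => //; have [] := gP b.
pose h (b : (size s).-tuple bool) : 'I_m := Ordinal (fI _ (tr b)).
have hinj : injective h.
  move=> b c /(congr1 val) /= fbc.
  have E := finj _ _ (mem_set (tr b)) (mem_set (tr c)) fbc.
  apply: val_inj; rewrite /= -(gP b).2 -(gP c).2; apply/eq_in_map => x xs.
  apply/idP/idP; rewrite !inE => gx.
    by have : (g b `&` [set` s]) x by []; rewrite E => -[].
  by have : (g c `&` [set` s]) x by []; rewrite -E => -[].
by have := leq_card h hinj; rewrite card_tuple card_bool card_ord.
Qed.

(** Sets that are separated in pairs by points of [s] have distinct patterns on
    [s].  If there were more than [(size s).+1 ^ k] of them, the Sauer-Shelah
    lemma would give [k] points of [s] with all [2 ^ k] traces, against the
    VC hypothesis. *)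
Lemma VC_trace_growth (d : measure_display) (X : measurableType d) (C : set (set X)) :
  VC_class C -> exists k : nat, forall (N : nat) (A : 'I_N -> set X) (s : seq X),
    (forall i, C (A i)) ->
    (forall i j, i != j -> has (fun x => x \in A i `+` A j) s) ->
    (N <= (size s).+1 ^ k)%N.
Proof.
move=> [_ [k VCk]]; exists k => N A s CA sep; rewrite leqNgt; apply/negP => big.
(* The points of a shattered mask must be distinct for their set to have
   exactly [k] elements. *)
pose u := undup s.
pose p (i : 'I_N) : (size u).-tuple bool := map_tuple (fun x => x \in A i) (in_tuple u).
have pinj : injective p.
  move=> i j pij; apply/eqP; apply: contraT => /sep /hasP[x xs /set_mem].
  have /eq_in_map/(_ x) : [seq y \in A i | y <- u] = [seq y \in A j | y <- u].
    exact: (congr1 val pij).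
  rewrite mem_undup setY_def => /(_ xs) E [] [/mem_set ax nax]; exfalso; apply/nax/set_mem.
    by rewrite -E.
  by rewrite E.
have [|m [sm cm shm]] := @sauer_shelah (size u) k [set p i | i in 'I_N]%SET.
  rewrite card_imset // card_ord (leq_ltn_trans _ big) //.
  case: (k) => [|l]; rewrite ?expn0 // leq_exp2r // ltnS size_undup //.
pose D := mask m u.
have uD : uniq D by rewrite mask_uniq // undup_uniq.
have sD : size D = k by rewrite size_mask.
have [|M [trM Mk]] := VCk [set` D].
  by rewrite -sD; exact: card_uniq_seq.
suff : (2 ^ size D <= M)%N by rewrite sD; lia.
apply: patterns_le_traces trM => // b sb.
have [|t /imsetP[i _ ->] <-] := shm b; first by rewrite sb sD.
by exists (A i) => //; rewrite /D map_mask.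
Qed.

(** * Total boundedness of VC classes *)

Lemma measurable_setY (d : measure_display) (X : measurableType d) (A B : set X) :
  measurable A -> measurable B -> measurable (A `+` B).
Proof. by move=> mA mB; rewrite setY_def; apply: measurableU; apply: measurableD. Qed.

(** The bound [N] is one more than the number of traces allowed on [m] points,
    where [m] is so large that some [m] points meet all the symmetric
    differences of [N] separated sets. *)
Lemma VC_packing (R : realType) (d : measure_display) (X : measurableType d)
    (mu : probability X R) (C : set (set X)) (e : R) :
  VC_class C -> 0 < e -> e <= 1 ->
  exists N : nat, forall A : 'I_N -> set X, (forall i, C (A i)) ->
    ~ (forall i j, i != j -> e < fine (mu (A i `+` A j))).
Proof.
move=> VC e0 e1; have [k growth] := VC_trace_growth VC; have [mC _] := VC.
have [m small] := exp_beats_poly k e0 e1.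
set N := (m.+1 ^ k).+1 in small; exists N => A CA sep.
(* The pairs of distinct indices form a type of their own, so that every
   [S p] has measure more than [e]. *)
pose I : finType := {p : 'I_N * 'I_N | p.1 != p.2}.
pose S (p : I) := A (val p).1 `+` A (val p).2.
have [||||s ss /allP hit] := @few_points_hit_all R d X mu I S e (enum {: I}) m.
- exact: e1.
- by move=> p; apply: measurable_setY; apply: mC.
- by move=> p; apply: sep; exact: (valP p).
- apply: le_lt_trans small; rewrite ler_wpM2l ?exprn_ge0 ?subr_ge0 // ler_nat.
  rewrite -cardE card_sig (leq_trans (max_card _)) //.
  by rewrite card_prod card_ord mulnn.
suff : (N <= (size s).+1 ^ k)%N by rewrite ss /N ltnn.
apply: growth CA _ => i j ij.
by apply: (hit (exist _ (i, j) ij)); rewrite mem_enum.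
Qed.

(** Without a finite net, a separated sequence could always be prolonged, against
    [VC_packing]. *)
Lemma VC_totally_bounded (R : realType) (d : measure_display) (X : measurableType d)
    (mu : probability X R) (C : set (set X)) (e : R) :
  VC_class C -> 0 < e -> e <= 1 ->
  exists s : seq (set X), (forall B, B \in s -> C B) /\
    forall A, C A -> exists2 B, B \in s & fine (mu (A `+` B)) <= e.
Proof.
move=> VC e0 e1; have [N packN] := VC_packing mu VC e0 e1.
apply: contrapT => nonet.
have [s [ss Cs sep]] : exists s : seq (set X), [/\ size s = N, forall B, B \in s -> C B
    & pairwise (fun A B => e < fine (mu (A `+` B))) s].
  elim: {packN}N => [|n [s [ss Cs sep]]]; first by exists [::].
  have [A [CA farA]] : exists A, C A /\ forall B, B \in s -> e < fine (mu (A `+` B)).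
    apply: contrapT => noA; apply: nonet; exists s; split => // A CA.
    apply: contrapT => noB; apply: noA; exists A; split => // B Bs.
    by rewrite ltNge; apply/negP => le; apply: noB; exists B.
  exists (A :: s); split => /=; first by rewrite ss.
    by move=> B; rewrite inE => /predU1P[->|/Cs].
  by rewrite sep andbT; apply/allP.
apply: (packN (fun i : 'I_N => nth set0 s i)) => [i|i j ij].
  by apply: Cs; rewrite mem_nth // ss.
have sep' a b : (a < b < N)%N -> e < fine (mu (nth set0 s a `+` nth set0 s b)).
  move=> /andP[ab bN]; move/pairwiseP : sep => /(_ set0 a b).
  by apply=> //; rewrite inE ss // (ltn_trans ab).
have [lt|gt|/val_inj E] := ltngtP i j.
- by apply: sep'; rewrite lt /=.
- by rewrite setYC; apply: sep'; rewrite gt /=.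
- by rewrite E eqxx in ij.
Qed.

(** * Stability of the mixing averages *)

Lemma measure_dist_le (R : realType) (d : measure_display) (X : measurableType d)
    (mu : probability X R) (E F G : set X) :
  measurable E -> measurable F -> measurable G ->
  E `<=` F `|` G -> F `<=` E `|` G ->
  `|fine (mu E) - fine (mu F)| <= fine (mu G).
Proof.
move=> mE mF mG.
have half (U V : set X) : measurable U -> measurable V -> U `<=` V `|` G ->
    fine (mu U) <= fine (mu V) + fine (mu G).
  move=> mU mV UV; rewrite -fineD ?fin_num_measure //.
  apply: fine_le; [exact: fin_num_measure|by rewrite fin_numD !fin_num_measure|].
  apply: (@le_trans _ _ (mu (V `|` G))); last exact: measureU2.
  by apply: le_measure; rewrite ?inE; [|exact: measurableU|].
move=> /(half _ _ mE mF) h1 /(half _ _ mF mE) h2.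
by rewrite ler_norml; lra.
Qed.

Lemma iter_measure_preserving (R : realType) (d : measure_display) (X : measurableType d)
    (mu : probability X R) (T : X -> X) (i : nat) :
  measure_preserving mu T -> measure_preserving mu (iter i T).
Proof.
move=> [mT pT]; elim: i => [|i [mi pi]]; first by split; [exact: measurable_id|].
split; first by apply: (measurableT_comp mT mi).
move=> B mB; rewrite -[RHS]pT // -[RHS]pi //.
by rewrite -[X in measurable X]setTI; exact: mT.
Qed.

(** Each term is the distance between a joint measure and a product of measures.
    The joint measure moves by at most the sum of the two distances because
    [iter i T] pulls [B `+` B'] back to a set of the same measure; the product
    moves by at most as much because its factors lie between 0 and 1. *)
Lemma mixing_avg_lipschitz (R : realType) (d : measure_display) (X : measurableType d)
    (mu : probability X R) (T : X -> X) (A A' B B' : set X) (n : nat) :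
  measure_preserving mu T ->
  measurable A -> measurable A' -> measurable B -> measurable B' ->
  mixing_avg mu T A B n <= mixing_avg mu T A' B' n +
    2 * (fine (mu (A `+` A')) + fine (mu (B `+` B'))).
Proof.
move=> pT mA mA' mB mB'; rewrite /mixing_avg.
set dA := fine (mu (A `+` A')); set dB := fine (mu (B `+` B')).
have mYA := measurable_setY mA mA'; have mYB := measurable_setY mB mB'.
have setY_cover (U V : set X) : U `<=` V `|` (U `+` V).
  by move=> x Ux; rewrite setY_def; have [|] := pselect (V x); [left|right; left].
have fine01 (U : set X) : measurable U -> 0 <= fine (mu U) <= 1.
  move=> mU; rewrite fine_ge0 //= -lee_fin fineK ?fin_num_measure //.
  exact: probability_le1.
have hA : `|fine (mu A) - fine (mu A')| <= dA.
  by apply: measure_dist_le => //; rewrite 1?[A `+` A']setYC; exact: setY_cover.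
have hB : `|fine (mu B) - fine (mu B')| <= dB.
  by apply: measure_dist_le => //; rewrite 1?[B `+` B']setYC; exact: setY_cover.
have dA0 : 0 <= dA by rewrite fine_ge0.
have dB0 : 0 <= dB by rewrite fine_ge0.
have [->|n0] := eqVneq n 0%N.
  by rewrite !big_ord0 !mulr0 add0r mulr_ge0 // addr_ge0.
have nR0 : (n%:R : R) != 0 by rewrite pnatr_eq0.
have -> : 2 * (dA + dB) = n%:R^-1 * \sum_(i < n) (2 * (dA + dB)).
  by rewrite sumr_const card_ord -[X in _ = _ * X]mulr_natl mulKf.
rewrite -mulrDr ler_wpM2l ?invr_ge0 // -big_split /=; apply: ler_sum => i _.
have [mTi pTi] := iter_measure_preserving i pT.
have mpre (U : set X) : measurable U -> measurable (iter i T @^-1` U).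
  by move=> mU; rewrite -[X in measurable X]setTI; exact: mTi.
set u := fine (mu (A `&` _)); set u' := fine (mu (A' `&` _)).
have hu : `|u - u'| <= dA + dB.
  rewrite /dB -pTi // -fineD ?fin_num_measure //; last exact: mpre.
  apply: (@le_trans _ _ (fine (mu ((A `+` A') `|` (iter i T @^-1` (B `+` B')))))).
    apply: measure_dist_le.
    - by apply: measurableI => //; exact: mpre.
    - by apply: measurableI => //; exact: mpre.
    - by apply: measurableU => //; exact: mpre.
    - move=> x [/(setY_cover _ A')[a|a] /(setY_cover B B' _)[b|b]];
        [by left; split|by right; right|by right; left|by right; left].
    - rewrite [A `+` A']setYC [B `+` B']setYC => x
        [/(setY_cover _ A)[a|a] /(setY_cover B' B _)[b|b]];
        [by left; split|by right; right|by right; left|by right; left].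
  apply: fine_le; rewrite ?fin_numD ?fin_num_measure //; try exact: mpre.
    by apply: measurableU => //; exact: mpre.
  by apply: measureU2 => //; exact: mpre.
have /andP[a0 a1] := fine01 _ mA; have /andP[b0 b1] := fine01 _ mB'.
have hprod : `|fine (mu A) * fine (mu B) - fine (mu A') * fine (mu B')| <= dA + dB.
  have -> : fine (mu A) * fine (mu B) - fine (mu A') * fine (mu B') =
     (fine (mu A) - fine (mu A')) * fine (mu B') +
     fine (mu A) * (fine (mu B) - fine (mu B')) by ring.
  apply: le_trans (ler_normD _ _) _; apply: lerD.
    by rewrite normrM (ger0_norm b0) (le_trans _ hA) // ler_piMr.
  by rewrite normrM (ger0_norm a0) (le_trans _ hB) // ler_piMl.
move: hu hprod; rewrite !ler_norml; set p := _ * fine (mu B); set p' := _ * fine (mu B').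
move=> /andP[u1 u2] /andP[p1 p2].
have := ler_norm (u' - p'); have := ler_norm (- (u' - p')); rewrite normrN; lra.
Qed.

(** * Uniform convergence over a VC class *)

Lemma VC_weakly_mixing_uniform (R : realType) (d : measure_display) (X : measurableType d)
    (mu : probability X R) (T : X -> X) (C : set (set X)) :
  measure_preserving mu T -> VC_class C -> weakly_mixing mu T ->
  sup [set mixing_avg mu T A B n | A in C & B in C] @[n --> \oo] --> (0 : R).
Proof.
move=> pT VC mix; have [mC _] := VC.
have avg0 A B n : 0 <= mixing_avg mu T A B n.
  by rewrite mulr_ge0 ?invr_ge0 // sumr_ge0.
apply/cvgrPdist_le => e e0.
(* Moving [A] and [B] by at most [h] costs at most [4 * h <= e / 2]; the net
   pairs account for the other [e / 2]. *)
pose h := Num.min 1 (e / 8).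
have h0 : 0 < h by rewrite lt_min ltr01 divr_gt0.
have h1 : h <= 1 by rewrite ge_min lexx.
have h8 : h <= e / 8 by rewrite ge_min lexx orbT.
have [s [Cs net]] := VC_totally_bounded mu VC h0 h1.
have small : \forall n \near \oo, forall p, p \in [seq (A, B) | A <- s, B <- s] ->
    mixing_avg mu T p.1 p.2 n <= e / 2.
  have : forall p, p \in [seq (A, B) | A <- s, B <- s] ->
      \forall n \near \oo, mixing_avg mu T p.1 p.2 n <= e / 2.
    move=> p /allpairsP[q [/Cs/mC q1 /Cs/mC q2 ->]] /=.
    have /cvgrPdist_le/(_ (e / 2)) := mix _ _ q1 q2.
    rewrite divr_gt0 // => /(_ isT); apply: filterS => n.
    by rewrite sub0r normrN ger0_norm.
  elim: [seq (A, B) | A <- s, B <- s] => [|p l IH] H.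
    by apply: nearW => n p; rewrite in_nil.
  have Hp := H p (mem_head _ _).
  have Hl := IH (fun q ql => H q (mem_behead (s := p :: l) ql)).
  by apply: filterS2 Hp Hl => n np nl q; rewrite inE => /predU1P[->|/nl].
apply: filterS small => n small.
have ubE : ubound [set mixing_avg mu T A B n | A in C & B in C] e.
  move=> _ [A CA [B CB <-]].
  have [A' A's hA] := net _ CA; have [B' B's hB] := net _ CB.
  have := @mixing_avg_lipschitz _ _ _ mu T A A' B B' n pT (mC _ CA) (mC _ (Cs _ A's))
    (mC _ CB) (mC _ (Cs _ B's)).
  have /= := small (A', B') (allpairs_f pair A's B's); lra.
rewrite sub0r normrN.
have [->|/set0P[x Ex]] := eqVneq [set mixing_avg mu T A B n | A in C & B in C] set0.
  by rewrite sup0 normr0 ltW.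
rewrite ger0_norm; first by apply: ge_sup => //; exists x.
apply: (@le_trans _ _ x); last by apply: sup_upper_bound => //; split; [exists x|exists e].
by case: Ex => A _ [B _ <-].
Qed.

Unset Implicit Arguments.
Set Strict Implicit.
Set Printing Implicit Defensive.

Theorem proposition2 (R : realType) (X : completeMetricType R)
  (hX : separable X) (mu : probability (borelType X) R)
  (T : borelType X -> borelType X) (hT : measure_preserving mu T)
  (C : set (set (borelType X))) (hCcount : countable C) (hCVC : VC_class C)
  (hmix : weakly_mixing mu T) :
  sup [set mixing_avg mu T A B n | A in C & B in C] @[n --> \oo] --> (0 : R).
Proof. exact: VC_weakly_mixing_uniform. Qed.
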